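(* Let $\mathbb{F}$ be a field with $\operatorname{char}\mathbb{F}\neq 2$, and let $L$ be a finite-dimensional 2-step nilpotent Lie superalgebra over $\mathbb{F}$. Then $L$ admits pure local anti-superderivations, i.e. there exists a local anti-superderivation of $L$ that is not an anti-superderivation of $L$.
   Context: A Lie superalgebra over $\mathbb{F}$ is a $\mathbb{Z}_2$-graded vector space $L=L_{\bar 0}\oplus L_{\bar 1}$ with a bilinear bracket satisfying $[L_\alpha,L_\beta]\subseteq L_{\alpha+\beta}$ and, for all $x\in L_\alpha$, $y\in L_\beta$, $z\in L$ with $\alpha,\beta\in\mathbb{Z}_2$ (in the first identity $x,y$ are homogeneous of degrees $|x|=\alpha$, $|y|=\beta$), $[x,y]=-(-1)^{|x||y|}[y,x]$ and $[x,[y,z]]=[[x,y],z]+(-1)^{|x||y|}[y,[x,z]]$. Lower central series: $L^0=L$, $L^1=[L,L]$, $L^k=[L,L^{k-1}]$ for $k\geq 1$. $L$ is nilpotent if $L^n=0$ for some positive integer $n$; the smallest such positive integer $n$ is the nilpotency index, and $L$ is then called $n$-step nilpotent. (So 2-step nilpotent means $L^1\neq 0$ and $L^2=0$.) A linear map $T:L\to L$ that is homogeneous of degree $|T|=\alpha\in\mathbb{Z}_2$ (i.e. $T(L_\beta)\subseteq L_{\alpha+\beta}$) is an anti-superderivation of degree $\alpha$ if $T([x,y])=-[T(x),y]-(-1)^{|T||x|}[x,T(y)]$ for all homogeneous $x\in L$ and all $y\in L$. Let $\operatorname{AntiDer}_\alpha(L)$ be the set of these, and $\operatorname{AntiDer}(L)=\operatorname{AntiDer}_{\bar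 0}(L)\oplus\operatorname{AntiDer}_{\bar 1}(L)$; the elements of $\operatorname{AntiDer}(L)$ are the anti-superderivations of $L$. A linear map $\Delta:L\to L$ is a local anti-superderivation if for every $x\in L$ there is an anti-superderivation $T_x\in\operatorname{AntiDer}(L)$ (depending on $x$) with $\Delta(x)=T_x(x)$. A pure local anti-superderivation is a local anti-superderivation that is not an anti-superderivation. *)

(* Defs.v *)
From HB Require Import structures.
From mathcomp Require Import all_boot all_order all_algebra.

Set Implicit Arguments.
Unset Strict Implicit.
Unset Printing Implicit Defensive.

Import GRing.Theory.

Local Open Scope ring_scope.

(* Degrees are elements of 'Z_2; in the exponent of a sign they are read as   *)
(* their representatives 0, 1 : nat.                                          *)
(* The Jacobi identity is only imposed as stated: in characteristic 3 it does *)
(* not force [x, [x, x]] = 0 for odd x.                                       *)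
Record lieSuperalgebra (F : fieldType) (L : vectType F) := LieSuperalgebra {
  homog : 'Z_2 -> {vspace L};
  homog_full : (homog 0%R + homog 1%R)%VS = fullv;
  homog_direct : directv (homog 0%R + homog 1%R)%VS;
  bracket : {bilinear L -> L -> L};
  bracket_homog : forall (a b : 'Z_2) (x y : L),
    x \in homog a -> y \in homog b -> bracket x y \in homog (a + b);
  bracket_skew : forall (a b : 'Z_2) (x y : L),
    x \in homog a -> y \in homog b ->
    bracket x y = - ((-1) ^+ (a * b)%N *: bracket y x);
  bracket_jacobi : forall (a b : 'Z_2) (x y z : L),
    x \in homog a -> y \in homog b ->
    bracket x (bracket y z) =
      bracket (bracket x y) z + (-1) ^+ (a * b)%N *: bracket y (bracket x z)
}.

Section LieSuperalgebraTheory.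

Variables (F : fieldType) (L : vectType F) (A : lieSuperalgebra L).

(* [U, V], the span of all [u, v]; see bracketvP. *)
Definition bracketv (U V : {vspace L}) : {vspace L} :=
  <<[seq bracket A u v | u <- vbasis U, v <- vbasis V]>>%VS.

Lemma memv_bracket (U V : {vspace L}) u v :
  u \in U -> v \in V -> bracket A u v \in bracketv U V.
Proof.
move=> /coord_vbasis-> /coord_vbasis->.
rewrite linear_sumlz; apply: memv_suml => i _.
rewrite linear_sumr; apply: memv_suml => j _.
rewrite linearZl_LR linearZr_LR !memvZ // memv_span //.
by apply/allpairsP; exists ((vbasis U)`_i, (vbasis V)`_j); rewrite !memt_nth.
Qed.

Lemma bracketvP (U V W : {vspace L}) :
  reflect (forall u v, u \in U -> v \in V -> bracket A u v \in W)
          (bracketv U V <= W)%VS.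
Proof.
apply: (iffP idP) => [sUVW u v Uu Vv | sUVW].
  by rewrite (subvP sUVW) ?memv_bracket.
apply/span_subvP=> _ /allpairsP[[u v] /= [Uu Vv ->]].
by rewrite sUVW ?vbasis_mem.
Qed.

Fixpoint lcs (k : nat) : {vspace L} :=
  if k is k'.+1 then bracketv fullv (lcs k') else fullv.

Definition step_nilpotent (n : nat) : Prop :=
  [/\ (0 < n)%N, lcs n = 0%VS
    & forall m, (0 < m)%N -> lcs m = 0%VS -> (n <= m)%N].

Definition antisuperder_deg (a : 'Z_2) (T : 'End(L)) : Prop :=
  (forall b : 'Z_2, (T @: homog A b <= homog A (a + b)%R)%VS) /\
  (forall (b : 'Z_2) (x y : L), x \in homog A b ->
     T (bracket A x y) =
       - bracket A (T x) y - (-1) ^+ (a * b)%N *: bracket A x (T y)).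

Definition antisuperder (T : 'End(L)) : Prop :=
  exists T0 T1 : 'End(L),
    [/\ antisuperder_deg 0 T0, antisuperder_deg 1 T1 & T = T0 + T1].

Definition local_antisuperder (D : 'End(L)) : Prop :=
  forall x : L, exists2 T : 'End(L), antisuperder T & D x = T x.

Definition pure_local_antisuperder (D : 'End(L)) : Prop :=
  local_antisuperder D /\ ~ antisuperder D.

End LieSuperalgebraTheory.

(* Main.v *)
(* Let P be a degree-preserving projection of L onto L^1 = [L, L]; L^1 is     *)
(* central. On L^1, P agrees with -1/2 (id - 3 P), and id - 3 P is an         *)
(* anti-superderivation, being 1 on ker P and -2 on L^1. At a point x outside *)
(* L^1, P agrees with a linear map into L^1 that kills L^1; the homogeneous   *)
(* components of such a map are anti-superderivations. But P is not an        *)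
(* anti-superderivation: it would give                                        *)
(*   [x, y] = P [x, y] = - [P x, y] - [x, P y] = 0.                           *)
Require Import Defs.
From HB Require Import structures.
From mathcomp Require Import all_boot all_order all_algebra.
From mathcomp Require Import ring.

Import GRing.Theory.

Local Open Scope ring_scope.

(** The anti-superderivation identity only sees a map through its effect on L^1 and modulo the
    centre. Two families satisfy it at once: the multiples of id - 3 P ([antisuperder_scale]) and
    all linear maps L / L^1 -> L^1 ([antisuperder_central]). Together they reproduce P at each
    single point ([lcs1_proj_local]), but [lcs1_proj_antisuperder] shows that P itself satisfies the
    identity only if L^1 = 0. P can be chosen to preserve degrees because L^1 is a graded subspace
    ([homog_proj_lcs1]). *)

Section AntiSuperderivations.

Set Implicit Arguments.
Unset Strict Implicit.

Variables (F : fieldType) (L : vectType F) (A : lieSuperalgebra L).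

Lemma Z2_cases (a : 'Z_2) : a = 0 \/ a = 1.
Proof. by case: a => [[|[|m]] //= ltm]; [left | right]; apply: val_inj. Qed.

Lemma Z2_neqE (a b : 'Z_2) : b != a -> b = 1 + a.
Proof.
by case: (Z2_cases a) => ->; case: (Z2_cases b) => -> // _; apply: val_inj.
Qed.

Lemma Z2_add11 : 1 + 1 = 0 :> 'Z_2.
Proof. exact: val_inj. Qed.

Lemma homog_cap0 (a : 'Z_2) : (homog A a :&: homog A (1 + a)%R)%VS = 0%VS.
Proof.
have /directv_addP cap0 := homog_direct A.
by case: (Z2_cases a) => ->; rewrite ?addr0 // Z2_add11 capvC.
Qed.

Definition homog_proj (a : 'Z_2) : 'End(L) :=
  daddv_pi (homog A a) (homog A (1 + a)%R).

Lemma homog_projP a x : homog_proj a x \in homog A a.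
Proof. exact: memv_pi. Qed.

Lemma homog_proj_id a x : x \in homog A a -> homog_proj a x = x.
Proof. by move=> Lx; apply: daddv_pi_id => //; apply: homog_cap0. Qed.

Lemma homog_proj_eq0 a x : x \in homog A (1 + a)%R -> homog_proj a x = 0.
Proof.
move=> Lx; have := daddv_pi_add (homog_cap0 a) (subvP (addvSr _ _) _ Lx).
rewrite (daddv_pi_id _ Lx) 1?capvC ?homog_cap0 //.
by move/eqP; rewrite -subr_eq0 addrK => /eqP.
Qed.

Lemma homog_projD x : homog_proj 0 x + homog_proj 1 x = x.
Proof.
have := daddv_pi_add (homog_cap0 0) (w := x).
by rewrite /homog_proj addr0 Z2_add11 homog_full memvf; apply.
Qed.

(** L^1 is spanned by brackets of homogeneous elements, and such a bracket is itself homogeneous, so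
    a projection either fixes it or kills it. *)
Lemma homog_proj_lcs1 a x : x \in lcs A 1 -> homog_proj a x \in lcs A 1.
Proof.
suff /subvP s : (lcs A 1 <= homog_proj a @^-1: lcs A 1)%VS.
  by move/s; rewrite -memv_preim.
apply/bracketvP => u v _ _; rewrite -memv_preim.
have homog_in i j :
    homog_proj a (bracket A (homog_proj i u) (homog_proj j v)) \in lcs A 1.
  have Luv := bracket_homog (homog_projP i u) (homog_projP j v).
  case: (eqVneq (i + j) a) => [<-|ne].
    by rewrite homog_proj_id // memv_bracket ?memvf.
  by rewrite homog_proj_eq0 ?mem0v // -(Z2_neqE ne).
rewrite -(homog_projD u) -(homog_projD v).
by rewrite linearDl !linearDr /= !linearD /= !memvD.
Qed.

Lemma homog_eq0 b x : x \in homog A b -> x \in homog A (1 + b)%R -> x = 0.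
Proof.
by move=> Lx L1x; apply/eqP; rewrite -memv0 -(homog_cap0 b) memv_cap Lx.
Qed.

Hypothesis nilA : lcs A 2 = 0%VS.

Lemma bracket_lcs1r x z : z \in lcs A 1 -> bracket A x z = 0.
Proof.
move=> Lz; apply/eqP; rewrite -memv0 -nilA.
by apply: memv_bracket; rewrite ?memvf.
Qed.

(** Skew-symmetry is available only for homogeneous elements, so both arguments are split; the
    components of z stay in L^1. *)
Lemma bracket_lcs1l x z : z \in lcs A 1 -> bracket A z x = 0.
Proof.
move=> Lz; rewrite -(homog_projD z) -(homog_projD x) linearDl !linearDr /=.
have skew0 i j : bracket A (homog_proj i z) (homog_proj j x) = 0.
  rewrite (bracket_skew (homog_projP i z) (homog_projP j x)).
  by rewrite bracket_lcs1r ?homog_proj_lcs1 // scaler0 oppr0.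
by rewrite !skew0 !addr0.
Qed.

(** All three terms of the identity vanish, since T kills brackets and has central values. *)
Lemma antisuperder_deg_central (a : 'Z_2) (T : 'End(L)) :
  (forall b, (T @: homog A b <= homog A (a + b)%R)%VS) ->
  (forall x, T x \in lcs A 1) -> (forall z, z \in lcs A 1 -> T z = 0) ->
  antisuperder_deg A a T.
Proof.
move=> degT imT kerT; split=> // b x y _.
rewrite (bracket_lcs1l _ (imT x)) (bracket_lcs1r _ (imT y)) scaler0 subr0 oppr0.
by rewrite kerT // memv_bracket ?memvf.
Qed.

Lemma antisuperder_central (T : 'End(L)) :
  (forall x, T x \in lcs A 1) -> (forall z, z \in lcs A 1 -> T z = 0) ->
  antisuperder A T.
Proof.
move=> imT kerT.
(* [C a] is the degree [a] component of [T]: it sends degree 0 to [a] and degree 1 to [a + 1]. *)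
pose C a : 'End(L) := (homog_proj a \o (T \o homog_proj 0))%VF
  + (homog_proj (a + 1) \o (T \o homog_proj 1))%VF.
have CE a x : C a x = homog_proj a (T (homog_proj 0 x))
    + homog_proj (a + 1) (T (homog_proj 1 x)).
  by rewrite add_lfunE !comp_lfunE.
have degC a : antisuperder_deg A a (C a).
  apply: antisuperder_deg_central => [b | x | z Lz]; first last.
  - by rewrite CE !kerT ?homog_proj_lcs1 // !linear0 addr0.
  - by rewrite CE memvD ?homog_proj_lcs1.
  apply/subvP => _ /memv_imgP[x Lx ->]; rewrite CE.
  case: (Z2_cases b) Lx => -> Lx.
    rewrite (@homog_proj_eq0 1) ?Z2_add11 // !linear0 !addr0.
    exact: homog_projP.
  by rewrite (@homog_proj_eq0 0) ?addr0 // !linear0 add0r homog_projP.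
exists (C 0), (C 1); split=> //; apply/lfunP => x.
rewrite add_lfunE !CE add0r Z2_add11 -{1}(homog_projD x) linearD /=.
rewrite -[in LHS](homog_projD (T (homog_proj 0 x))).
rewrite -[in LHS](homog_projD (T (homog_proj 1 x))).
by rewrite [RHS]addrACA [X in _ = _ + X]addrC.
Qed.

(** This is the map P. Projecting each degree separately makes it degree-preserving, which an
    arbitrary projection onto L^1 need not be. *)
Definition lcs1_proj : 'End(L) :=
  (projv (homog A 0 :&: lcs A 1) \o homog_proj 0)%VF
  + (projv (homog A 1 :&: lcs A 1) \o homog_proj 1)%VF.

Lemma lcs1_projE x :
  lcs1_proj x = projv (homog A 0 :&: lcs A 1) (homog_proj 0 x)
              + projv (homog A 1 :&: lcs A 1) (homog_proj 1 x).
Proof. by rewrite add_lfunE !comp_lfunE. Qed.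

Lemma lcs1_projP x : lcs1_proj x \in lcs A 1.
Proof. by rewrite lcs1_projE memvD // (subvP (capvSr _ _) _ (memv_proj _ _)). Qed.

Lemma lcs1_proj_id z : z \in lcs A 1 -> lcs1_proj z = z.
Proof.
move=> Lz; have cap_in a : homog_proj a z \in (homog A a :&: lcs A 1)%VS.
  by apply/memv_capP; split; [apply: homog_projP | apply: homog_proj_lcs1].
by rewrite lcs1_projE (projv_id (cap_in 0)) (projv_id (cap_in 1)) homog_projD.
Qed.

Lemma lcs1_proj_homog b x : x \in homog A b -> lcs1_proj x \in homog A b.
Proof.
rewrite lcs1_projE; case: (Z2_cases b) => -> Lx.
  rewrite (@homog_proj_eq0 1) ?Z2_add11 // linear0 addr0.
  exact: (subvP (capvSl _ _) _ (memv_proj _ _)).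
rewrite (@homog_proj_eq0 0) ?addr0 // linear0 add0r.
exact: (subvP (capvSl _ _) _ (memv_proj _ _)).
Qed.

(** Modulo the centre id - 3 P is the identity, so the right-hand side is -2 [x, y], which is also
    its value at [x, y]. *)
Lemma antisuperder_scale (c : F) :
  antisuperder A (c *: (\1%VF - 3 *: lcs1_proj)).
Proof.
set T := c *: _.
have TE x : T x = c *: (x - 3 *: lcs1_proj x).
  by rewrite scale_lfunE add_lfunE opp_lfunE id_lfunE scale_lfunE.
exists T, 0; split; last by rewrite addr0.
  split=> [b | b x y Lx].
    apply/subvP => _ /memv_imgP[x Lx ->].
    by rewrite TE add0r memvZ // memvB // memvZ // lcs1_proj_homog.
  rewrite !TE mul0n expr0 scale1r lcs1_proj_id ?memv_bracket ?memvf //.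
  rewrite linearZl_LR linearZr_LR linearBl linearBr /= linearZl_LR linearZr_LR /=.
  rewrite (bracket_lcs1l _ (lcs1_projP x)) (bracket_lcs1r _ (lcs1_projP y)).
  rewrite scaler0 !subr0 -[X in _ *: (X - _)]scale1r -scalerBl scalerA.
  by rewrite -opprD -scalerDl -scaleNr; congr (_ *: _); ring.
split=> [b | b x y Lx]; last by rewrite !lfunE /= linear0l linear0r scaler0 subr0 oppr0.
by apply/subvP => _ /memv_imgP[x _ ->]; rewrite lfunE mem0v.
Qed.

Lemma lcs1_proj_local : 2%N \notin [pchar F] -> local_antisuperder A lcs1_proj.
Proof.
move=> char2 x; have two_neq0 : 2%:R != 0 :> F.
  by apply: contra char2 => /eqP e; apply/andP; rewrite e.
case: (eqVneq (x - lcs1_proj x) 0) => [/eqP | w_neq0].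
  rewrite subr_eq0 => /eqP Px.
  (* Here x is in L^1, where id - 3 P is multiplication by -2; inverting it uses that the
     characteristic is not 2. *)
  exists (- 2^-1 *: (\1%VF - 3 *: lcs1_proj)); first exact: antisuperder_scale.
  rewrite [RHS]scale_lfunE [in RHS]add_lfunE [in RHS]opp_lfunE id_lfunE.
  rewrite [in RHS]scale_lfunE -Px.
  rewrite -[X in _ *: (X - _)]scale1r -scalerBl scalerA -[LHS]scale1r.
  by congr (_ *: _); field.
pose X := vbasis {:L}; pose w := x - lcs1_proj x.
have [i wi] : exists i, coord X i w != 0.
  apply/existsP; apply: contraNT w_neq0; rewrite negb_exists => /forallP w0.
  rewrite -/w (coord_vbasis (memvf w)) big1 // => i _.
  by have /negPn/eqP-> := w0 i; rewrite scale0r.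
(* A coordinate that is nonzero at [w], composed with id - P, gives a functional that vanishes on
   L^1; normalized to 1 at [x], it yields f x = P x. *)
pose f y : L := (coord X i (y - lcs1_proj y) / coord X i w) *: lcs1_proj x.
have f_lin : linear f.
  move=> k u v; rewrite /f linearP opprD addrACA -scalerBr linearP.
  by rewrite mulrDl scalerDl -mulrA scalerA.
pose lf := GRing.isLinear.Build _ _ _ _ f f_lin.
pose fL : {linear L -> L} := HB.pack f lf.
exists (linfun fL); last by rewrite [RHS]lfunE /= /f -/w divff // scale1r.
apply: antisuperder_central => [y | z Lz]; rewrite lfunE /= /f.
  by rewrite memvZ // lcs1_projP.
by rewrite lcs1_proj_id // subrr linear0 mul0r scale0r.
Qed.

Lemma lcs1_proj_antisuperder : antisuperder A lcs1_proj -> lcs A 1 = 0%VS.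
Proof.
case=> T0 [T1 [[deg0 anti0] [deg1 _] defP]].
have P_T0 b x : x \in homog A b -> lcs1_proj x = T0 x.
  move=> Lx; have T1x : T1 x = lcs1_proj x - T0 x.
    by rewrite defP add_lfunE addrC addKr.
  (* [T1] shifts degrees, while P - [T0] preserves them, so [T1 x] lies in both components. *)
  suff T1x0 : T1 x = 0 by apply/eqP; rewrite -subr_eq0 -T1x T1x0.
  apply: (@homog_eq0 b); last exact: (subvP (deg1 b)) (memv_img _ Lx).
  rewrite T1x memvB ?lcs1_proj_homog //.
  by have := subvP (deg0 b) _ (memv_img _ Lx); rewrite add0r.
have {P_T0} P_T0 x : lcs1_proj x = T0 x.
  rewrite -(homog_projD x) [LHS]linearD [RHS]linearD /=.
  by rewrite !(P_T0 _ _ (homog_projP _ _)).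
have bracket0 b x y : x \in homog A b -> bracket A x y = 0.
  move=> Lx; have := anti0 b x y Lx.
  rewrite -!P_T0 lcs1_proj_id ?memv_bracket ?memvf // => ->.
  by rewrite bracket_lcs1l ?bracket_lcs1r ?lcs1_projP // scaler0 subr0 oppr0.
apply/eqP; rewrite -subv0; apply/bracketvP => x y _ _.
rewrite -(homog_projD x) linearDl /=.
by rewrite !(bracket0 _ _ _ (homog_projP _ _)) addr0 mem0v.
Qed.

End AntiSuperderivations.

Theorem theorem3p6 (F : fieldType) (L : vectType F) (A : lieSuperalgebra L) :
  2%N \notin [pchar F] -> step_nilpotent A 2 ->
  exists D : 'End(L), pure_local_antisuperder A D.
Proof.
move=> char2 [_ nilA index2]; exists (lcs1_proj A).
split; first exact: lcs1_proj_local.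
(* L^1 = 0 would contradict the minimality of the index, giving 2 <= 1. *)
by move=> /(lcs1_proj_antisuperder nilA) /(index2 1%N isT).
Qed.
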